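(* Let $K$ be a field complete with respect to a non-trivial non-Archimedean valuation $v\colon K\to\mathbb{R}\cup\{+\infty\}$, with valuation ring $R=\{a\in K: v(a)\ge 0\}$, maximal ideal $\mathfrak{m}=\{a\in K: v(a)>0\}$ and residue field $k=R/\mathfrak{m}$. Let $f_1,\dots,f_r\in\mathcal{R}_n=R\langle x_1,\dots,x_n\rangle$ and let $\overline{f_1},\dots,\overline{f_r}\in k[x_1,\dots,x_n]$ be their reductions modulo $\mathfrak{m}$. Suppose that $$\overline{A}:=k[x_1,\dots,x_n]/(\overline{f_1},\dots,\overline{f_r})$$ is a finite-dimensional $k$-vector space. Then the set $V_R(\{f_1,\dots,f_r\})$ of common zeros of $f_1,\dots,f_r$ in $R^n$ is finite and $$\#V_R(\{f_1,\dots,f_r\})\le \sum_{m}\dim_k(\overline{A}_m)\le \dim_k(\overline{A}),$$ where the sum ranges over the (finitely many) maximal ideals $m\subset\overline{A}$ such that $\overline{A}/m=k$, and $\overline{A}_m$ denotes the localization of $\overline{A}$ at $m$.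
   Context: The valuation may be non-discrete. $\mathcal{R}_n=R\langle x_1,\dots,x_n\rangle$ is the ring of formal power series $\sum_{I\in\mathbb{N}^n}a_Ix^I$ with $a_I\in R$ and $v(a_I)\to+\infty$ as $|I|\to+\infty$. The reduction modulo $\mathfrak{m}$ of $f\in\mathcal{R}_n$ is obtained by reducing each coefficient modulo $\mathfrak{m}$; by the convergence condition it is a polynomial in $k[x_1,\dots,x_n]$. For a subset $S\subset\mathcal{R}_n$, $V_R(S)=\{a\in R^n: f(a)=0 \text{ for all } f\in S\}$. *)

(* Defs.v *)
From HB Require Import structures.
From mathcomp Require Import all_boot all_order all_algebra.
From mathcomp Require Import finmap.
From mathcomp Require Import boolp classical_sets cardinality fsbigop.
From mathcomp Require Import reals constructive_ereal.
(* The notations of mpoly clash with those of classical_sets, so only its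
   constants are imported: [mpoly n k] is {mpoly k[n]}, [multinom n] is
   'X_{1..n}, [bmultinom n b] is 'X_{1..n < b}, [mpolyX k I] is 'X_[I] and
   [mcoeff I p] is p@_I. *)
From mathcomp Require Import -(notations) mpoly.
From mathcomp Require Import ring.

Set Implicit Arguments.
Unset Strict Implicit.
Unset Printing Implicit Defensive.

Import Order.TTheory GRing.Theory Num.Theory.
Local Open Scope ring_scope.
Local Open Scope classical_set_scope.
Local Open Scope quotient_scope.

Record valuation (R : realType) (K : fieldType) := Valuation {
  val_fun :> K -> \bar R;
  val_neq_ninfty : forall x, val_fun x != -oo%E;
  val_eq_pinfty : forall x, (val_fun x == +oo%E) = (x == 0);
  valM : forall x y, val_fun (x * y) = (val_fun x + val_fun y)%E;
  valD : forall x y, (Order.min (val_fun x) (val_fun y) <= val_fun (x + y)%R)%E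
}.

Section ValuedField.
Context {R : realType} {K : fieldType}.
Variable v : valuation R K.

Definition val_nontrivial := exists x : K, x != 0 /\ v x != 0%E.

Definition val_cvg (u : nat -> K) (l : K) :=
  forall M : R, exists N, forall i, (N <= i)%N -> (M%:E < v (u i - l)%R)%E.

Definition val_cauchy (u : nat -> K) :=
  forall M : R, exists N, forall i j, (N <= i)%N -> (N <= j)%N ->
    (M%:E < v (u i - u j)%R)%E.

Definition val_complete := forall u, val_cauchy u -> exists l, val_cvg u l.

Lemma val0 : v 0 = +oo%E.
Proof. by apply/eqP; rewrite val_eq_pinfty. Qed.

Lemma val_fin x : x != 0 -> v x \is a fin_num.
Proof. by move=> x0; rewrite fin_numE val_neq_ninfty val_eq_pinfty. Qed.

Lemma val1 : v 1 = 0%E.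
Proof.
have /fineK f1 := val_fin (oner_neq0 K).
have := valM v 1 1; rewrite mulr1 -f1 -EFinD => -[] /eqP.
by rewrite -subr_eq0 opprD addNKr oppr_eq0 => /eqP ->.
Qed.

Lemma valN x : v (- x) = v x.
Proof.
have N1 : v (-1) = 0%E.
  have /fineK f1 : v (-1) \is a fin_num by apply: val_fin; rewrite oppr_eq0 oner_eq0.
  have := valM v (-1) (-1); rewrite mulrNN mulr1 val1 -f1 -EFinD => -[] /eqP.
  by rewrite eq_sym -mulr2n mulrn_eq0 /= => /eqP ->.
by rewrite -mulN1r valM N1 add0e.
Qed.

Lemma valV x : x != 0 -> (v (x^-1)%R + v x)%E = 0%E.
Proof. by move=> x0; rewrite -valM mulVf // val1. Qed.

Definition in_vring : {pred K} := [pred x | (0 <= v x)%E].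

Lemma in_vring_subring : subring_closed in_vring.
Proof.
split=> [|x y|x y]; rewrite !inE.
- by rewrite val1.
- by move=> x0 y0; apply: le_trans (valD v x (- y)); rewrite le_min x0 valN.
- by move=> x0 y0; rewrite valM adde_ge0.
Qed.
HB.instance Definition _ := GRing.isSubringClosed.Build K in_vring in_vring_subring.

Record vring := VRing { vring_val :> K; _ : vring_val \in in_vring }.
HB.instance Definition _ := [isSub for vring_val].
HB.instance Definition _ := [Choice of vring by <:].
HB.instance Definition _ := [SubChoice_isSubComNzRing of vring by <:].

Lemma vring_ge0 (a : vring) : (0 <= v a)%E.
Proof. exact: (valP a). Qed.

Definition in_vmax : {pred vring} := [pred a : vring | (0 < v a)%E].

Lemma in_vmax_ideal : idealr_closed in_vmax.
Proof.
split=> [||a x y]; rewrite !inE.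
- by rewrite /= val0 lt0y.
- by rewrite /= val1 ltxx.
- move=> x0 y0; apply: lt_le_trans (valD v _ _).
  by rewrite lt_min y0 andbT valM /= lte_spaddre // ?vring_ge0.
Qed.
HB.instance Definition _ := isIdealr.Build vring in_vmax in_vmax_ideal.

Definition residue := {ideal_quot in_vmax}.
HB.instance Definition _ := GRing.ComNzRing.on residue.

Definition res (a : vring) : residue := \pi_residue a.

Lemma res_eq0 a : (res a == 0) = (a \in in_vmax).
Proof. by rewrite -[X in X \in _]subr0 Quotient.idealrBE !piE. Qed.

Lemma resB : zmod_morphism res.
Proof. by move=> a b; rewrite /res !piE. Qed.

Lemma resM : monoid_morphism res.
Proof. by split=> [|a b]; rewrite /res !piE. Qed.
HB.instance Definition _ := GRing.isZmodMorphism.Build vring residue res resB.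
HB.instance Definition _ := GRing.isMonoidMorphism.Build vring residue res resM.

Lemma residue_inv_ex (q : residue) : q != 0 -> exists q' : residue, q' * q = 1.
Proof.
have -> : q = res (repr q) by rewrite /res reprK.
set a := repr q; rewrite res_eq0 inE => va.
have va0 : v a = 0%E.
  by apply/eqP; rewrite eq_le vring_ge0 andbT leNgt; exact: va.
have a0 : vring_val a != 0 by apply: contraNneq va => ->; rewrite val0 lt0y.
have iP : (vring_val a)^-1 \in in_vring.
  by have := valV a0; rewrite va0 adde0 inE /= => ->.
exists (res (VRing iP)); rewrite -rmorphM -(rmorph1 res); congr (res _).
by apply: val_inj; rewrite /= mulVf.
Qed.

Definition residue_inv (q : residue) : residue :=
  if q == 0 then 0 else xget 0 [set q' | q' * q = 1].

Lemma residue_mulVf (q : residue) : q != 0 -> residue_inv q * q = 1.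
Proof.
move=> q0; rewrite /residue_inv (negbTE q0).
exact: (xgetPex 0 (residue_inv_ex q0)).
Qed.

Lemma residue_inv0 : residue_inv 0 = 0.
Proof. by rewrite /residue_inv eqxx. Qed.

HB.instance Definition _ :=
  GRing.ComNzRing_isField.Build residue residue_mulVf residue_inv0.

Record tate (n : nat) := Tate {
  tate_coef :> multinom n -> vring;
  tate_cvg : forall M : R, exists N, forall I : multinom n,
    (N <= mdeg I)%N -> (M%:E < v (tate_coef I))%E
}.

Section Tate.
Variable n : nat.
Implicit Types (f : tate n) (a : vring ^ n).

Definition tate_psum f a (N : nat) : vring :=
  \sum_(I : bmultinom n N) f I * \prod_(i < n) a i ^+ (I : multinom n) i.

(* The value f(a) is the limit of the partial sums over |I| < N; it exists and
   is unique when K is complete, see [tate_evalP] and [val_cvg_uniq]. *)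
Definition tate_eval f a : vring :=
  xget 0 [set l : vring | val_cvg (fun N => vring_val (tate_psum f a N)) l].

Definition zeros (S : set (tate n)) : set (vring ^ n) :=
  [set a | forall f, S f -> tate_eval f a = 0].

Lemma val_cvg_uniq u l l' : val_cvg u l -> val_cvg u l' -> l = l'.
Proof.
move=> ul ul'; apply/eqP; rewrite -subr_eq0 -(val_eq_pinfty v).
apply/negPn/negP => nfin.
have /fineK fE : v (l - l') \is a fin_num.
  by rewrite fin_numE val_neq_ninfty.
have [N h] := ul (fine (v (l - l')%R)).
have [N' h'] := ul' (fine (v (l - l')%R)).
have {}h := h (maxn N N') (leq_maxl _ _).
have {}h' := h' (maxn N N') (leq_maxr _ _).
rewrite fE in h h'.
have := valD v (- (u (maxn N N') - l)) (u (maxn N N') - l').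
rewrite [X in (_ <= v X)%E](_ : _ = l - l'); last by ring.
by rewrite leNgt lt_min valN h h'.
Qed.

Lemma tate_psum_sub f a N N' : (N <= N')%N ->
  tate_psum f a N' - tate_psum f a N =
    \sum_(I : bmultinom n N' | (N <= mdeg I)%N)
       f I * \prod_(i < n) a i ^+ (I : multinom n) i.
Proof.
move=> NN'; apply/eqP; rewrite subr_eq addrC; apply/eqP.
rewrite /tate_psum (bigID (fun I : bmultinom n N' => mdeg I < N)%N) /=.
congr (_ + _); last by apply: eq_bigl => I; rewrite -leqNgt.
pose h (I : bmultinom n N) : bmultinom n N' :=
  BMultinom (leq_trans (bmdeg I) NN').
rewrite (reindex_omap h (fun I : bmultinom n N' => insub (I : multinom n))) /=.
  apply: eq_bigl => I; rewrite bmdeg /=.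
  by rewrite (valK I) eqxx.
move=> I IN; rewrite (insubT (fun m : multinom n => mdeg m < N)%N IN) /=.
by congr Some; apply: val_inj.
Qed.

Lemma tate_psum_tail f a (M : R) : exists N, forall N', (N <= N')%N ->
  (M%:E < v (vring_val (tate_psum f a N') - vring_val (tate_psum f a N))%R)%E.
Proof.
have [N h] := tate_cvg f M; exists N => N' NN'.
rewrite -[(_ - _)%R]/(vring_val (tate_psum f a N' - tate_psum f a N)).
rewrite tate_psum_sub //.
elim/big_ind : _ => [|x y hx hy|I NI]; first by rewrite val0 ltry.
  by apply: lt_le_trans (valD v x y); rewrite lt_min hx.
by rewrite valM (lt_le_trans (h I NI)) // leeDl // vring_ge0.
Qed.

Lemma tate_evalP f a : val_complete ->
  val_cvg (fun N => vring_val (tate_psum f a N)) (tate_eval f a).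
Proof.
move=> Kc.
apply: (@xgetPex _ 0 [set l : vring | val_cvg _ l]).
have [M|l hl] := Kc (fun N => vring_val (tate_psum f a N)).
  have [N hN] := tate_psum_tail f a M; exists N => i j Ni Nj.
  set s := fun N => vring_val (tate_psum f a N).
  rewrite [X in (_ < v X)%E](_ : _ = (s i - s N) - (s j - s N)); last by rewrite /s; ring.
  by apply: lt_le_trans (valD v _ _); rewrite lt_min valN !hN.
have lP : l \in in_vring.
  have [N /(_ N (leqnn N)) hN] := hl 0.
  rewrite inE; have -> : l = vring_val (tate_psum f a N) - (vring_val (tate_psum f a N) - l).
    by ring.
  apply: le_trans (valD v _ _).
  by rewrite le_min vring_ge0 valN ltW.
by exists (VRing lP).
Qed.

Lemma red_bound f : exists b, forall I : multinom n,
  (b <= mdeg I)%N -> f I \in in_vmax.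
Proof. by have [N h] := tate_cvg f 0; exists N => I /h. Qed.

Definition red f : mpoly n residue :=
  \sum_(I : bmultinom n (sval (cid (red_bound f)))) res (f I) *: mpolyX _ I.

Lemma mcoeff_red f (I : multinom n) : mcoeff I (red f) = res (f I).
Proof.
rewrite /red; case: cid => b /= hb.
case: (ltnP (mdeg I) b) => [Ib|bI].
  by rewrite (mcoeff_mpoly (fun J => res (f J))).
rewrite raddf_sum big1 /= => [|J _].
  by apply/esym/eqP; rewrite res_eq0 hb.
rewrite mcoeffZ mcoeffX; case: eqP => [JI|]; last by rewrite mulr0.
by have := bmdeg J; rewrite JI ltnNge bI.
Qed.

End Tate.
End ValuedField.

(* Vector.axiom d V: V is linearly isomorphic to 'rV_d. *)
Definition has_dim (k : fieldType) (V : lmodType k) (d : nat) : Prop :=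
  inhabited (Vector.axiom d V).

Definition finite_dim (k : fieldType) (V : lmodType k) : Prop :=
  exists d, has_dim V d.

(* Meaningful only when V is finite-dimensional. *)
Definition dimension (k : fieldType) (V : lmodType k) : nat :=
  xget 0%N [set d | has_dim V d].

Lemma has_dim_leq (k : fieldType) (V : lmodType k) d d' :
  has_dim V d -> has_dim V d' -> (d <= d')%N.
Proof.
move=> [[f flin [f' fK f'K]]] [[g glin gbij]].
pose h (u : 'rV[k]_d) := g (f' u).
have hlin : linear h.
  move=> c x y; rewrite /h -glin; congr g; apply: (can_inj fK).
  by rewrite flin !f'K.
pose H : {linear 'rV[k]_d -> 'rV[k]_d'} :=
  HB.pack h (GRing.isLinear.Build k 'rV[k]_d 'rV[k]_d' *:%R h hlin).
suff : row_free (lin1_mx H) by move=> /eqP <-; exact: rank_leq_col.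
rewrite -kermx_eq0; apply/eqP/row_matrixP => i.
have := mulmx_ker (lin1_mx H) => /(congr1 (row i)).
rewrite row_mul mul_rV_lin1 row0 => Hi.
apply: (can_inj f'K); apply: (bij_inj gbij); rewrite row0.
exact: etrans Hi (esym (linear0 H)).
Qed.

Lemma has_dim_uniq (k : fieldType) (V : lmodType k) d d' :
  has_dim V d -> has_dim V d' -> d = d'.
Proof. by move=> h h'; apply/eqP; rewrite eqn_leq !(@has_dim_leq k V). Qed.

Definition restr_scalars (k A : comPzRingType) (phi : {rmorphism k -> A}) : Type := A.

Section RestrictScalars.
Variables (k A : comPzRingType) (phi : {rmorphism k -> A}).
HB.instance Definition _ := GRing.ComPzRing.on (restr_scalars phi).

Definition restr_scale (c : k) (x : restr_scalars phi) : restr_scalars phi :=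
  (phi c * x : A).

Lemma restr_scaleA a b x : restr_scale a (restr_scale b x) = restr_scale (a * b) x.
Proof. by rewrite /restr_scale rmorphM mulrA. Qed.

Lemma restr_scale1 : left_id 1 restr_scale.
Proof. by move=> x; rewrite /restr_scale rmorph1 mul1r. Qed.

Lemma restr_scaleDr : right_distributive restr_scale +%R.
Proof. by move=> a x y; rewrite /restr_scale [LHS]mulrDr. Qed.

Lemma restr_scaleDl x : {morph restr_scale^~ x : a b / a + b}.
Proof. by move=> a b; rewrite /restr_scale rmorphD [LHS]mulrDl. Qed.

HB.instance Definition _ := GRing.Zmodule_isLmodule.Build k (restr_scalars phi)
  restr_scaleA restr_scale1 restr_scaleDr restr_scaleDl.
End RestrictScalars.

(* The ideals of [mathcomp.algebra.ring_quotient] are proper, whereas the ideal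
   generated by a family of polynomials may be the unit ideal. *)
Record ideal (A : comPzRingType) := Ideal {
  ideal_set :> A -> Prop;
  ideal0 : ideal_set 0;
  idealD : forall x y, ideal_set x -> ideal_set y -> ideal_set (x + y);
  ideal_mul : forall a x, ideal_set x -> ideal_set (a * x)
}.

Section Quotient.
Variables (A : comPzRingType) (I : ideal A).

Definition ideal_pred : {pred A} := [pred x | `[< I x >]].

Lemma ideal_predE x : (x \in ideal_pred) = `[< I x >].
Proof. by []. Qed.

Lemma ideal_pred_zmod : zmod_closed ideal_pred.
Proof.
split=> [|x y]; rewrite !ideal_predE; first exact/asboolP/ideal0.
move=> /asboolP Ix /asboolP Iy; apply/asboolP/idealD => //.
by rewrite -mulN1r; apply: ideal_mul.
Qed.
HB.instance Definition _ := GRing.isZmodClosed.Build A ideal_pred ideal_pred_zmod.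

Definition quot_ring := {ideal_quot ideal_pred}.
HB.instance Definition _ := GRing.Zmodule.on quot_ring.

Definition quot_proj (x : A) : quot_ring := \pi_{ideal_quot ideal_pred} x.

Lemma quot_projP x y : quot_proj x = quot_proj y <-> I (x - y).
Proof.
split=> [/eqP|Ixy]; last apply/eqP.
  by rewrite /quot_proj -Quotient.idealrBE ideal_predE => /asboolP.
by rewrite /quot_proj -Quotient.idealrBE ideal_predE; apply/asboolP.
Qed.

Lemma quot_reprK (q : quot_ring) : quot_proj (repr q) = q.
Proof. exact: reprK. Qed.

Lemma quot_proj_zmod : zmod_morphism quot_proj.
Proof. by move=> x y; rewrite /quot_proj !piE. Qed.
HB.instance Definition _ :=
  GRing.isZmodMorphism.Build A quot_ring quot_proj quot_proj_zmod.

Definition quot_one : quot_ring := quot_proj 1.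
Definition quot_mul (p q : quot_ring) : quot_ring := quot_proj (repr p * repr q).

Lemma quot_mulE x y : quot_mul (quot_proj x) (quot_proj y) = quot_proj (x * y).
Proof.
apply/quot_projP.
have /quot_projP Ix := quot_reprK (quot_proj x).
have /quot_projP Iy := quot_reprK (quot_proj y).
set x' := repr _ in Ix *; set y' := repr _ in Iy *.
have -> : x' * y' - x * y = y' * (x' - x) + x * (y' - y) by ring.
by apply: idealD; apply: ideal_mul.
Qed.

Lemma quot_mulA : associative quot_mul.
Proof.
move=> x y z; rewrite -[x]quot_reprK -[y]quot_reprK -[z]quot_reprK.
by rewrite !quot_mulE mulrA.
Qed.

Lemma quot_mulC : commutative quot_mul.
Proof.
by move=> x y; rewrite -[x]quot_reprK -[y]quot_reprK !quot_mulE mulrC.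
Qed.

Lemma quot_mul1 : left_id quot_one quot_mul.
Proof. by move=> x; rewrite -[x]quot_reprK quot_mulE mul1r. Qed.

Lemma quot_mulDl : left_distributive quot_mul +%R.
Proof.
move=> x y z; rewrite -[x]quot_reprK -[y]quot_reprK -[z]quot_reprK.
by rewrite -raddfD !quot_mulE mulrDl raddfD.
Qed.

HB.instance Definition _ := GRing.Zmodule_isComPzRing.Build quot_ring
  quot_mulA quot_mulC quot_mul1 quot_mulDl.

Lemma quot_proj_monoid : monoid_morphism quot_proj.
Proof. by split=> // x y; rewrite -quot_mulE. Qed.
HB.instance Definition _ :=
  GRing.isMonoidMorphism.Build A quot_ring quot_proj quot_proj_monoid.
End Quotient.

Section IdealGenerated.
Variables (A : comPzRingType) (r : nat) (g : 'I_r -> A).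

Definition in_ideal_gen (x : A) := exists c : 'I_r -> A, x = \sum_(i < r) c i * g i.

Lemma ideal_gen0 : in_ideal_gen 0.
Proof. by exists (fun=> 0); rewrite big1 // => i _; rewrite mul0r. Qed.

Lemma ideal_genD x y : in_ideal_gen x -> in_ideal_gen y -> in_ideal_gen (x + y).
Proof.
move=> [c ->] [d ->]; exists (fun i => c i + d i).
by rewrite -big_split; apply: eq_bigr => i _; rewrite mulrDl.
Qed.

Lemma ideal_genM a x : in_ideal_gen x -> in_ideal_gen (a * x).
Proof.
move=> [c ->]; exists (fun i => a * c i).
by rewrite big_distrr; apply: eq_bigr => i _; rewrite /= mulrA.
Qed.

Definition ideal_gen : ideal A := Ideal ideal_gen0 ideal_genD ideal_genM.
End IdealGenerated.

Definition is_maximal (A : comPzRingType) (m : ideal A) : Prop :=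
  ~ m 1 /\
  forall J : ideal A, (forall x, m x -> J x) -> ~ J 1 -> forall x, J x -> m x.

Record maxideal (A : comPzRingType) := MaxIdeal {
  maxideal_ideal :> ideal A;
  maxidealP : is_maximal maxideal_ideal
}.
HB.instance Definition _ (A : comPzRingType) := gen_eqMixin (maxideal A).
HB.instance Definition _ (A : comPzRingType) := gen_choiceMixin (maxideal A).

Lemma ideal_ext (A : comPzRingType) (I J : ideal A) :
  (forall x, I x <-> J x) -> I = J.
Proof.
case: I J => [S S0 SD SM] [T T0 TD TM] /= ST.
have {}ST : S = T by apply/funext => x; apply/propext.
subst T; congr Ideal; exact: Prop_irrelevance.
Qed.

Lemma maxideal_ext (A : comPzRingType) (m m' : maxideal A) :
  (forall x, m x <-> m' x) -> m = m'.
Proof.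
case: m m' => [I mI] [J mJ] /= /ideal_ext IJ.
subst J; congr MaxIdeal; exact: Prop_irrelevance.
Qed.

Record mulset (A : comPzRingType) := MulSet {
  mulset_pred :> {pred A};
  mulset1 : 1 \in mulset_pred;
  mulsetM : forall s t, s \in mulset_pred -> t \in mulset_pred ->
    s * t \in mulset_pred
}.

Section Localization.
Variables (A : comPzRingType) (S : mulset A).

Definition frac_pair := (A * {s : A | s \in mulset_pred S})%type.
Definition num (x : frac_pair) : A := x.1.
Definition den (x : frac_pair) : A := sval x.2.

Lemma denP x : den x \in mulset_pred S.
Proof. exact: (valP x.2). Qed.

Definition mk_frac (a s : A) (Ss : s \in mulset_pred S) : frac_pair := (a, exist _ s Ss).

Definition frac_equiv (x y : frac_pair) : bool :=
  `[< exists2 u, u \in mulset_pred S & u * (num x * den y - num y * den x) = 0 >].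

Lemma frac_equiv_is_equiv : equiv_class_of frac_equiv.
Proof.
split=> [x|x y|y x z].
- by apply/asboolP; exists 1; [exact: mulset1 | rewrite subrr mulr0].
- by apply/asbool_equiv_eq; split=> -[u Su h]; exists u => //;
    apply: oppr_inj; rewrite oppr0 -h; ring.
- move=> /asboolP[u Su hu] /asboolP[w Sw hw]; apply/asboolP.
  exists (u * w * den y); first by rewrite !mulsetM ?denP.
  have -> : u * w * den y * (num x * den z - num z * den x) =
    w * den z * (u * (num x * den y - num y * den x)) +
    u * den x * (w * (num y * den z - num z * den y)) by ring.
  by rewrite hu hw !mulr0 addr0.
Qed.
Canonical frac_equiv_equiv := EquivRelPack frac_equiv_is_equiv.
Canonical frac_equiv_encModRel := defaultEncModRel frac_equiv.

Definition loc := {eq_quot frac_equiv}.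
HB.instance Definition _ := Choice.on loc.

Definition frac (x : frac_pair) : loc := \pi_{eq_quot frac_equiv} x.

Lemma fracP x y : frac x = frac y <->
  exists2 u, u \in mulset_pred S & u * (num x * den y - num y * den x) = 0.
Proof. by split=> [/eqmodP/asboolP|h] //; apply/eqmodP/asboolP. Qed.

Lemma frac_reprK (q : loc) : frac (repr q) = q.
Proof. exact: reprK. Qed.

Definition add_pair x y := mk_frac (num x * den y + num y * den x) (mulsetM (denP x) (denP y)).
Definition mul_pair x y := mk_frac (num x * num y) (mulsetM (denP x) (denP y)).
Definition opp_pair x := mk_frac (- num x) (denP x).

Definition loc_zero : loc := frac (mk_frac 0 (mulset1 S)).
Definition loc_one : loc := frac (mk_frac 1 (mulset1 S)).
Definition loc_add (p q : loc) : loc := frac (add_pair (repr p) (repr q)).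
Definition loc_mul (p q : loc) : loc := frac (mul_pair (repr p) (repr q)).
Definition loc_opp (p : loc) : loc := frac (opp_pair (repr p)).

Lemma frac_eq x y : num x * den y = num y * den x -> frac x = frac y.
Proof.
by move=> h; apply/fracP; exists 1; [exact: mulset1 | rewrite h subrr mulr0].
Qed.

Lemma loc_addE x y : loc_add (frac x) (frac y) = frac (add_pair x y).
Proof.
have /fracP[u Su] := frac_reprK (frac x).
have /fracP[w Sw] := frac_reprK (frac y).
rewrite /loc_add; set x' := repr (frac x); set y' := repr (frac y) => hw hu.
apply/fracP; exists (u * w); first exact: mulsetM.
rewrite [num (add_pair _ _)]/= [den (add_pair _ _)]/= [num (add_pair x y)]/=.
rewrite [den (add_pair x y)]/=.
have -> : u * w * ((num x' * den y' + num y' * den x') * (den x * den y) -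
    (num x * den y + num y * den x) * (den x' * den y')) =
  w * den y * den y' * (u * (num x' * den x - num x * den x')) +
  u * den x * den x' * (w * (num y' * den y - num y * den y')) by ring.
by rewrite hu hw !mulr0 addr0.
Qed.

Lemma loc_mulE x y : loc_mul (frac x) (frac y) = frac (mul_pair x y).
Proof.
have /fracP[u Su] := frac_reprK (frac x).
have /fracP[w Sw] := frac_reprK (frac y).
rewrite /loc_mul; set x' := repr (frac x); set y' := repr (frac y) => hw hu.
apply/fracP; exists (u * w); first exact: mulsetM.
rewrite [num (mul_pair _ _)]/= [den (mul_pair _ _)]/= [num (mul_pair x y)]/=.
rewrite [den (mul_pair x y)]/=.
have -> : u * w * (num x' * num y' * (den x * den y) -
    num x * num y * (den x' * den y')) =
  w * num y' * den y * (u * (num x' * den x - num x * den x')) +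
  u * num x * den x' * (w * (num y' * den y - num y * den y')) by ring.
by rewrite hu hw !mulr0 addr0.
Qed.

Lemma loc_oppE x : loc_opp (frac x) = frac (opp_pair x).
Proof.
have /fracP[u Su hu] := frac_reprK (frac x).
apply/fracP; exists u => //.
apply: oppr_inj; rewrite oppr0 -[RHS]hu.
rewrite [num (opp_pair _)]/= [den (opp_pair _)]/= [num (opp_pair x)]/=.
by rewrite [den (opp_pair x)]/=; ring.
Qed.

Ltac loc_ring := rewrite ?(loc_addE, loc_mulE, loc_oppE);
  apply: frac_eq; rewrite /add_pair /mul_pair /opp_pair /mk_frac /num /den /=; ring.

Lemma loc_addA : associative loc_add.
Proof.
move=> x y z; rewrite -[x]frac_reprK -[y]frac_reprK -[z]frac_reprK; loc_ring.
Qed.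

Lemma loc_addC : commutative loc_add.
Proof. by move=> x y; rewrite -[x]frac_reprK -[y]frac_reprK; loc_ring. Qed.

Lemma loc_add0 : left_id loc_zero loc_add.
Proof. by move=> x; rewrite -[x]frac_reprK; loc_ring. Qed.

Lemma loc_addN : left_inverse loc_zero loc_opp loc_add.
Proof. by move=> x; rewrite -[x]frac_reprK; loc_ring. Qed.

HB.instance Definition _ :=
  GRing.isZmodule.Build loc loc_addA loc_addC loc_add0 loc_addN.

Lemma loc_mulA : associative loc_mul.
Proof.
move=> x y z; rewrite -[x]frac_reprK -[y]frac_reprK -[z]frac_reprK; loc_ring.
Qed.

Lemma loc_mulC : commutative loc_mul.
Proof. by move=> x y; rewrite -[x]frac_reprK -[y]frac_reprK; loc_ring. Qed.

Lemma loc_mul1 : left_id loc_one loc_mul.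
Proof. by move=> x; rewrite -[x]frac_reprK; loc_ring. Qed.

Lemma loc_mulDl : left_distributive loc_mul loc_add.
Proof.
move=> x y z; rewrite -[x]frac_reprK -[y]frac_reprK -[z]frac_reprK; loc_ring.
Qed.

HB.instance Definition _ := GRing.Zmodule_isComPzRing.Build loc
  loc_mulA loc_mulC loc_mul1 loc_mulDl.

Definition loc_map (a : A) : loc := frac (mk_frac a (mulset1 S)).

Lemma loc_map_zmod : zmod_morphism loc_map.
Proof.
move=> a b; rewrite -[RHS]/(loc_add (loc_map a) (loc_opp (loc_map b))) /loc_map.
loc_ring.
Qed.

Lemma loc_map_monoid : monoid_morphism loc_map.
Proof.
split=> // a b; rewrite -[RHS]/(loc_mul (loc_map a) (loc_map b)) /loc_map.
loc_ring.
Qed.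
HB.instance Definition _ := GRing.isZmodMorphism.Build A loc loc_map loc_map_zmod.
HB.instance Definition _ := GRing.isMonoidMorphism.Build A loc loc_map loc_map_monoid.
End Localization.

Section MaxIdealComplement.
Variables (A : comPzRingType) (m : maxideal A).

Lemma maxideal_prime a b : m (a * b) -> m a \/ m b.
Proof.
move=> mab; have [ma|nma] := pselect (m a); [by left | right].
have [m1 mmax] := maxidealP m.
pose J x := exists y c, m y /\ x = y + c * a.
have J0 : J 0 by exists 0, 0; split; [exact: ideal0 | ring].
have JD x y : J x -> J y -> J (x + y).
  move=> [x1 [c [mx ->]]] [y1 [d [my ->]]]; exists (x1 + y1), (c + d).
  by split; [exact: idealD | ring].
have JM c x : J x -> J (c * x).
  move=> [y [d [my ->]]]; exists (c * y), (c * d).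
  by split; [exact: ideal_mul | ring].
have [J1|nJ1] := pselect (J 1); last first.
  exfalso; apply: nma; apply: (mmax (Ideal J0 JD JM)) => //=.
    by move=> x mx; exists x, 0; split => //; ring.
  by exists 0, 1; split; [exact: ideal0 | ring].
move: J1 => [y [c [my e]]].
have -> : b = b * y + c * (a * b) by rewrite -[LHS]mulr1 e; ring.
by apply: idealD; exact: ideal_mul.
Qed.

Definition maxideal_compl_pred : {pred A} := [pred x | `[< ~ m x >]].

Lemma maxideal_compl1 : 1 \in maxideal_compl_pred.
Proof. by apply/asboolP; have [] := maxidealP m. Qed.

Lemma maxideal_complM s t : s \in maxideal_compl_pred ->
  t \in maxideal_compl_pred -> s * t \in maxideal_compl_pred.
Proof.
by move=> /asboolP ms /asboolP mt; apply/asboolP => /maxideal_prime[].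
Qed.

Definition maxideal_compl : mulset A := MulSet maxideal_compl1 maxideal_complM.
End MaxIdealComplement.

Section MaxIdealsOfAlgebra.
Variables (k : fieldType) (A : comPzRingType) (phi : {rmorphism k -> A}).

(* A/m = k: the structure map k -> A -> A/m is an isomorphism. *)
Definition rational_maxideals : set (maxideal A) :=
  [set m | bijective (fun c : k => quot_proj m (phi c))].

Definition local_space (m : maxideal A) : lmodType k :=
  restr_scalars (loc_map (maxideal_compl m) \o phi).
End MaxIdealsOfAlgebra.

Section ReductionAlgebra.
Context {R : realType} {K : fieldType} {v : valuation R K} {n r : nat}.
Variable f : 'I_r -> tate v n.

Definition red_ideal : ideal (mpoly n (residue v)) := ideal_gen (fun i => red (f i)).

Definition red_alg : comPzRingType := quot_ring red_ideal.

Definition red_alg_scalar : {rmorphism residue v -> red_alg} :=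
  quot_proj red_ideal \o @mpolyC n (residue v).

Definition red_space : lmodType (residue v) := restr_scalars red_alg_scalar.
End ReductionAlgebra.

(* Main.v *)
From HB Require Import structures.
Require Import Defs.
From mathcomp Require Import all_boot all_order all_algebra.
From mathcomp Require Import finmap.
From mathcomp Require Import boolp classical_sets cardinality fsbigop.
From mathcomp Require Import reals constructive_ereal.
From mathcomp Require Import -(notations) mpoly.
From mathcomp Require Import ring.

(* Over a rational maximal ideal m, let b_1, ..., b_d be lifts to R[x] of
   generators of the local algebra A_m, and let a_1, ..., a_N be zeros of the
   f_j reducing to m. If N > d, some nonzero K-linear combination L of the
   evaluations at the a_i kills every b_l. Modulo m, every monomial is a
   combination of the b_l in A_m, so v(L(x^I)) >= s e + c implies
   v(L(x^I)) >= (s + 1) e + c, where e > 0 is uniform because only finitely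
   many products x_k b_l have to be rewritten. Hence L kills all polynomials,
   which is absurd since the a_i are distinct. Denominators outside m are
   handled by a lift E of an idempotent of A that is a unit at the a_i; the
   same idempotents (Fitting's lemma) give sum_m dim A_m <= dim A. *)

Set Implicit Arguments.
Unset Strict Implicit.
Unset Printing Implicit Defensive.

Import Order.TTheory GRing.Theory Num.Theory.

Local Open Scope classical_set_scope.
Local Open Scope ring_scope.

(** * Finite-dimensional spaces *)

Lemma linear_comb (k : fieldType) (V W : lmodType k) (f : V -> W) (T : finType)
    (c : T -> k) (b : T -> V) :
  linear f -> f (\sum_t c t *: b t) = \sum_t c t *: f (b t).
Proof.
move=> flin.
pose F : {linear V -> W} := HB.pack f (GRing.isLinear.Build k V W *:%R f flin).
apply: etrans (linear_sum F _ _ _) _.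
by apply: eq_bigr => t _; apply: (linearZZ F).
Qed.

Lemma linear_fun0 (k : fieldType) (V W : lmodType k) (f : V -> W) :
  linear f -> f 0 = 0.
Proof. by move=> flin; have := flin (-1) 0 0; rewrite !scaleN1r !addNr. Qed.

Section LinearAlgebra.
Context {k : fieldType} {V : lmodType k}.

Definition independent (T : finType) (b : T -> V) : Prop :=
  forall c : T -> k, \sum_t c t *: b t = 0 -> forall t, c t = 0.

Definition spanning (T : finType) (b : T -> V) : Prop :=
  forall x, exists c : T -> k, x = \sum_t c t *: b t.

Lemma has_dim_basis d : has_dim V d -> exists2 b : 'I_d -> V, independent b & spanning b.
Proof.
move=> [[g glin [h gK hK]]].
have hlin : linear h.
  by move=> c x y; apply: (can_inj gK); rewrite hK glin !hK.
have hE (c : 'I_d -> k) : \sum_i c i *: h (delta_mx 0 i) = h (\row_i c i).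
  rewrite -linear_comb //; congr h; rewrite [RHS]row_sum_delta.
  by apply: eq_bigr => i _; rewrite mxE.
exists (fun i => h (delta_mx 0 i)) => [c|x].
  rewrite hE => /(congr1 g); rewrite hK => e i.
  have := congr1 (fun u : 'rV_d => u 0 i) e; rewrite mxE => ->.
  by rewrite (linear_fun0 glin) mxE.
exists (fun i => g x 0 i); rewrite hE.
by rewrite -[LHS]gK; congr h; apply/rowP => i; rewrite mxE.
Qed.

(** Coordinates come from [choice]; independence makes them unique, hence linear in x. *)
Lemma basis_has_dim d (b : 'I_d -> V) : independent b -> spanning b -> has_dim V d.
Proof.
move=> bi bs; have [c cE] := choice bs.
have cP x e : x = \sum_i e i *: b i -> forall i, c x i = e i.
  move=> xE i; apply/eqP; rewrite -subr_eq0; apply/eqP.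
  move: i; apply: (bi (fun i => c x i - e i)).
  under eq_bigr do rewrite scalerBl.
  by rewrite sumrB -cE -xE subrr.
split; exists (fun x => \row_i c x i).
  move=> a x y; apply/rowP => i; rewrite !mxE.
  apply: (cP _ (fun i => a * c x i + c y i)); rewrite {1}(cE x) {1}(cE y) scaler_sumr -big_split.
  by apply: eq_bigr => j _; rewrite /= scalerDl scalerA.
exists (fun u : 'rV_d => \sum_i u 0 i *: b i) => [x|u].
  by rewrite [RHS]cE; apply: eq_bigr => i _; rewrite mxE.
by apply/rowP => i; rewrite mxE (cP _ (fun i => u 0 i)).
Qed.

(** A linear relation lets one generator be eliminated; after at most D eliminations the remaining
    ones form a basis. *)
Lemma spanning_finite_dim D (b : 'I_D -> V) : spanning b -> finite_dim V.
Proof.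
elim: D b => [|D IH] b bs.
  by exists 0; apply: (basis_has_dim (b := b)) => // c _ [].
have [bi|] := pselect (independent b); first by exists D.+1; apply: (basis_has_dim bi).
move=> /existsNP[c] /not_implyP[c0] /existsNP[i /eqP ci].
apply: (IH (fun j => b (lift i j))) => x.
have [e xE] := bs x.
exists (fun j => e (lift i j) - e i / c i * c (lift i j)).
have bE : b i = - \sum_(j < D) (c (lift i j) / c i) *: b (lift i j).
  move: c0; rewrite (bigD1_ord i) //= => /eqP; rewrite addr_eq0 => /eqP c0.
  rewrite -[LHS]scale1r -(mulVf ci) -scalerA c0 scalerN scaler_sumr.
  by congr (- _); apply: eq_bigr => j _; rewrite scalerA mulrC.
rewrite xE (bigD1_ord i) //= bE scalerN scaler_sumr -sumrN -big_split.
apply: eq_bigr => j _ /=; rewrite scalerA -scaleNr -scalerDl; congr (_ *: _).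
by rewrite mulrA mulrAC addrC.
Qed.

(** The coordinate matrix of an independent family has independent rows, so its rank [#|T|] is at
    most its number D of columns. *)
Lemma independent_leq D (T : finType) (b : T -> V) :
  has_dim V D -> independent b -> (#|T| <= D)%N.
Proof.
move=> [[g glin [h gK hK]]] bi.
pose M := \matrix_(i < #|T|, j < D) g (b (enum_val i)) 0 j.
suff : row_free M by move=> /eqP <-; exact: rank_leq_col.
rewrite -kermx_eq0; apply/eqP/row_matrixP => i; rewrite row0.
have /(congr1 (row i)) := mulmx_ker M; rewrite row_mul row0.
move: (row i _) => u uM; apply/rowP => j.
pose c t := u 0 (enum_rank t).
rewrite mxE -[j]enum_valK; apply: (bi c).
apply: (can_inj gK); rewrite (linear_fun0 glin) linear_comb //.
apply/rowP => l; have := congr1 (fun u : 'rV_D => u 0 l) uM; rewrite !mxE => <-.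
rewrite summxE (reindex (fun i : 'I_#|T| => enum_val i)) /=; last exact/onW_bij/enum_val_bij.
by apply: eq_bigr => s _; rewrite !mxE /c enum_valK.
Qed.

Lemma dimensionE d : has_dim V d -> dimension V = d.
Proof.
by move=> Vd; apply: (has_dim_uniq (xgetPex 0%N (ex_intro _ d Vd))).
Qed.

End LinearAlgebra.

(** * Finite-dimensional algebras and their localizations *)

Section FiniteAlgebra.
Context {k : fieldType} {A : comPzRingType} (phi : {rmorphism k -> A}).
Hypothesis A_fin : finite_dim (restr_scalars phi).
Implicit Types (m : maxideal A).

(** The D + 1 powers of s of exponent at most D are linearly dependent; dividing a relation by its
    lowest nonzero coefficient exhibits the lowest power as a multiple of the next one. *)
Lemma power_stable (s : A) : exists j y, s ^+ j = s ^+ j.+1 * y.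
Proof.
have [D AD] := A_fin.
pose b (i : 'I_D.+1) : restr_scalars phi := s ^+ i.
have /existsNP[c /not_implyP[c0 /existsNP[i0 /eqP ci0]]] : ~ independent b.
  by move=> /(independent_leq AD); rewrite card_ord ltnn.
case: (@arg_minnP _ i0 (fun i => c i != 0) (fun i => i : nat) ci0) => j cj jmin.
exists j, (- \sum_(i < D.+1 | (j < i)%N) phi (c i / c j) * s ^+ (i - j.+1)).
have {}c0 : phi (c j) * s ^+ j + \sum_(i < D.+1 | (j < i)%N) phi (c i) * s ^+ i = 0.
  have {}c0 : \sum_(i < D.+1) phi (c i) * s ^+ i = 0 := c0.
  rewrite -[RHS]c0 [RHS](bigD1 j) //=; congr (_ + _).
  rewrite [LHS]big_mkcond [RHS]big_mkcond /=; apply: eq_bigr => i _.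
  case: ltngtP => [ji|ij|/ord_inj ->]; last by rewrite eqxx.
    by rewrite ifT //; apply: contraTneq ji => ->; rewrite ltnn.
  have /eqP ci : c i == 0 by apply: contraLR ij => /jmin; rewrite leqNgt.
  by case: ifP => // _; rewrite ci rmorph0 mul0r.
have cjV : phi (c j)^-1 * phi (c j) = 1 by rewrite -rmorphM mulVf ?rmorph1.
move/eqP: c0; rewrite addr_eq0 => /eqP c0.
rewrite mulrN -[LHS]mul1r -cjV -mulrA c0 mulrN !mulr_sumr; congr (- _).
apply: eq_bigr => i ji; rewrite -[in LHS](subnKC ji) exprD rmorphM; ring.
Qed.

(* Fitting's lemma: the idempotent e = t s cuts A into a factor where s is
   invertible and one where s is nilpotent. *)
Lemma fitting (s : A) : exists N t,
  (t * s) * (t * s) = t * s /\ s ^+ N * (1 - t * s) = 0.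
Proof.
have [j [y sj]] := power_stable s.
have st N : s ^+ j = s ^+ (j + N) * y ^+ N.
  elim: N => [|N IH]; first by rewrite addn0 mulr1.
  rewrite {1}IH [in LHS]exprD {1}sj [in RHS]exprD !exprS; ring.
have {}st : s ^+ j.+1 = s ^+ j.+1 * (s ^+ j.+1 * y ^+ j.+1).
  by rewrite {1}exprS {1}(st j.+1) exprD [X in _ = X * _]exprS; ring.
(* Here t s = a b with a = s^(j+1) and b = y^(j+1), and [st] reads a = a (a b). *)
exists j.+1, (s ^+ j * y ^+ j.+1).
have -> : s ^+ j * y ^+ j.+1 * s = s ^+ j.+1 * y ^+ j.+1 by rewrite [in RHS]exprS; ring.
split; last by rewrite mulrBr mulr1 -st subrr.
set a := s ^+ j.+1 in st *; set b := y ^+ j.+1 in st *.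
have -> : a * b * (a * b) = a * (a * b) * b by ring.
by rewrite -st.
Qed.

Lemma maxideal_notin1 m : ~ m 1.
Proof. by case: (maxidealP m). Qed.

Lemma maxideal_notin_exp m s N : ~ m s -> ~ m (s ^+ N).
Proof.
move=> ms; elim: N => [|N IH]; first by rewrite expr0; apply: maxideal_notin1.
by rewrite exprS => /maxideal_prime[].
Qed.

Lemma loc_map_eq0 m a :
  loc_map (maxideal_compl m) a = 0 <-> exists2 u, ~ m u & u * a = 0.
Proof.
split=> [/fracP[u /asboolP mu]|[u mu ua]].
  by rewrite /num /den /= mulr1 mul0r subr0; exists u.
by apply/fracP; exists u; [exact/asboolP | rewrite /num /den /= mulr1 mul0r subr0].
Qed.

Lemma loc_map_eq1 m a :
  loc_map (maxideal_compl m) a = 1 <-> exists2 u, ~ m u & u * (1 - a) = 0.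
Proof.
rewrite -loc_map_eq0 loc_map_zmod rmorph1.
by split=> [h|/eqP]; [rewrite h subrr | rewrite subr_eq0 => /eqP].
Qed.

(** If s is outside m, so is s^N, which kills 1 - e. If s is in m, then so is e = t s, and 1 - e
    lies outside m and kills e. *)
Lemma fitting_loc (s : A) : exists e t, [/\ e = t * s, e * e = e &
  forall m, (~ m s -> loc_map (maxideal_compl m) e = 1) /\
            (m s -> loc_map (maxideal_compl m) e = 0)].
Proof.
have [N [t [ee se]]] := fitting s.
exists (t * s), t; split=> // m; split=> ms.
  by apply/loc_map_eq1; exists (s ^+ N) => //; apply: maxideal_notin_exp.
apply/loc_map_eq0; exists (1 - t * s).
  move=> m1; apply: (@maxideal_notin1 m); rewrite -(subrK (t * s) 1).
  by apply: idealD => //; apply: ideal_mul.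
by rewrite mulrBl mul1r ee subrr.
Qed.

(** For s outside m, the t of Fitting's lemma becomes an inverse of s in the localization, so a / s
    is the image of a t. *)
Lemma loc_map_surj m (q : loc (maxideal_compl m)) :
  exists a, loc_map (maxideal_compl m) a = q.
Proof.
rewrite -[q]frac_reprK; case: (repr q) => a [s Ss].
have /asboolP ms := Ss.
have [_ [t [-> _ /(_ m)[/(_ ms) h _]]]] := fitting_loc s.
have /loc_map_eq1[u mu ue] := h.
exists (a * t); apply/fracP; exists u; first exact/asboolP.
rewrite /num /den /= mulr1.
have -> : u * (a * t * s - a) = - a * (u * (1 - t * s)) by ring.
by rewrite ue mulr0.
Qed.

Lemma loc_map_linear m :
  linear (loc_map (maxideal_compl m) : restr_scalars phi -> local_space phi m).
Proof.
pose F : {rmorphism A -> _} := loc_map (maxideal_compl m).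
by move=> c x y; apply: etrans (rmorphD F _ _) _; congr (_ + _); apply: (rmorphM F).
Qed.

Lemma local_space_finite_dim m : finite_dim (local_space phi m).
Proof.
have [D /has_dim_basis[b _ bs]] := A_fin.
pose b' i : local_space phi m := loc_map (maxideal_compl m) (b i).
apply: (spanning_finite_dim (b := b')) => q.
have [a <-] := loc_map_surj q; have [c ->] := bs a; exists c.
exact: linear_comb (loc_map_linear m).
Qed.

Lemma local_space_dimension m : has_dim (local_space phi m) (dimension (local_space phi m)).
Proof. by have [d hd] := local_space_finite_dim m; rewrite (dimensionE hd). Qed.

(** Turns a bound on the sum of local dimensions into one on the number of maximal ideals. In
    dimension 0 the local ring would have 1 = 0, so some u outside m would be 0. *)
Lemma local_space_dimension_gt0 m : (0 < dimension (local_space phi m))%N.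
Proof.
have := local_space_dimension m; case: dimension => // /has_dim_basis[b _ bs].
have [c] := bs (1 : loc (maxideal_compl m)); rewrite big_ord0.
have -> : 1 = loc_map (maxideal_compl m) 1 by rewrite rmorph1.
by move=> /loc_map_eq0[u mu]; rewrite mulr1 => u0; case: mu; rewrite u0; apply: ideal0.
Qed.

(** Otherwise m' is contained in m, and maximality of m' forces equality. *)
Lemma maxideal_neq_ex m m' : m <> m' -> exists2 s, m' s & ~ m s.
Proof.
move=> mm'; apply: contrapT => h; apply: mm'.
have sub x : m' x -> m x by move=> m'x; apply: contrapT => mx; apply: h; exists x.
apply: maxideal_ext => x; split=> [mx|]; last exact: sub.
by have [_ max] := maxidealP m'; apply: max mx => //; apply: maxideal_notin1.
Qed.

(** e_i is the product over j != i of the Fitting idempotent of an element of M_j outside M_i, which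
    maps to 1 at M_i and to 0 at M_j. *)
Lemma separating_idempotents N (M : 'I_N -> maxideal A) : injective M ->
  exists e : 'I_N -> A, forall i j,
    loc_map (maxideal_compl (M j)) (e i) = (i == j)%:R.
Proof.
move=> Minj.
have /choice[e eP] (ij : 'I_N * 'I_N) : exists e, ij.1 != ij.2 ->
    loc_map (maxideal_compl (M ij.1)) e = 1 /\ loc_map (maxideal_compl (M ij.2)) e = 0.
  have [->|nij] := eqVneq ij.1 ij.2; first by exists 0.
  have /maxideal_neq_ex[s sj si] : M ij.1 <> M ij.2 by move=> /Minj /eqP; rewrite (negbTE nij).
  by have [e [_ [_ _ h]]] := fitting_loc s; exists e => _; split; apply h.
exists (fun i => \prod_(j | i != j) e (i, j)) => i j; rewrite rmorph_prod.
have [<-|nij] := eqVneq i j; first by rewrite big1 // => l /(eP (i, l))[].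
by rewrite (bigD1 j) //= (proj2 (eP (i, j) nij)) mul0r.
Qed.

(** Lift a basis of each local space to A and multiply it by the separating element of its ideal.
    Localizing at one ideal isolates its block, so all these families together are independent in
    A. *)
Lemma sum_local_dimension_leq (s : seq (maxideal A)) : uniq s ->
  (\sum_(m <- s) dimension (local_space phi m) <= dimension (restr_scalars phi))%N.
Proof.
move=> us; have [D AD] := A_fin; rewrite (dimensionE AD).
pose M (i : 'I_(size s)) := tnth (in_tuple s) i.
have Minj : injective M by apply/tuple_uniqP.
have [e eP] := separating_idempotents Minj.
pose d i := dimension (local_space phi (M i)).
have hb i : exists b : 'I_(d i) -> local_space phi (M i), independent b.
  by have [b] := has_dim_basis (local_space_dimension (M i)); exists b.
have hB i : exists b : 'I_(d i) -> A,
    independent (fun l => loc_map (maxideal_compl (M i)) (b l) : local_space phi (M i)).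
  have [b bi] := hb i; have [B BE] := choice (fun l => loc_map_surj (b l)).
  by exists B; rewrite (funext BE).
pose B i := sval (cid (hB i)).
have Bi i := svalP (cid (hB i)).
pose F (t : {i : 'I_(size s) & 'I_(d i)}) : restr_scalars phi := e (tag t) * B _ (tagged t).
suff Find : independent F.
  have := independent_leq AD Find; rewrite card_tagged sumnE big_map big_enum /=.
  under eq_bigr do rewrite card_ord.
  by rewrite [in X in _ -> X](big_tnth _ _ s).
move=> c c0 [i l].
apply: (Bi i (fun l => c (Tagged (fun i => 'I_(d i)) l))) => {l}.
pose h : restr_scalars phi -> local_space phi (M i) := loc_map (maxideal_compl (M i)).
have hlin : linear h := @loc_map_linear (M i).
have := congr1 h c0; rewrite linear_comb // linear_fun0 // => hc.
pose G j (l : 'I_(d j)) : local_space phi (M i) :=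
  c (Tagged (fun i => 'I_(d i)) l) *: h (F (Tagged (fun i => 'I_(d i)) l)).
transitivity (\sum_j \sum_(l < d j) G j l); last first.
  by rewrite -[RHS]hc (sig_big_dep _ _ G) /=; apply: eq_bigr => -[].
have FE j (l : 'I_(d j)) :
    loc_map (maxideal_compl (M i)) (F (Tagged (fun i => 'I_(d i)) l)) =
      (j == i)%:R * loc_map (maxideal_compl (M i)) (B j l).
  by rewrite /F /= (loc_map_monoid _).2 eP.
rewrite (bigD1 i) //= [X in _ + X]big1 ?addr0 => [|j ji].
  by apply: eq_bigr => l _; rewrite /G /h FE eqxx mul1r.
apply: big1 => l _; rewrite /G /h FE (negbTE ji) mul0r.
exact: (@scaler0 _ (local_space phi (M i)) _).
Qed.
End FiniteAlgebra.

(** * Valuation estimates for functionals on polynomials *)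

Lemma uniform_positive {R : realType} (T : finType) (P : T -> R -> Prop) :
  (forall t e e', e' <= e -> P t e -> P t e') ->
  (forall t, exists2 e, 0 < e & P t e) ->
  exists2 e, 0 < e & forall t, P t e.
Proof.
move=> Pmono h.
have /choice[e eP] t : exists e, 0 < e /\ P t e by have [e] := h t; exists e.
(* The default 1 keeps the minimum positive when T is empty. *)
exists (\big[Order.min/1]_t e t).
  by apply: lt_bigmin => // t _; case: (eP t).
by move=> t; have [_] := eP t; apply: Pmono; apply: bigmin_le.
Qed.

Section ValuationBounds.
Context {R : realType} {K : fieldType} {v : valuation R K}.
Implicit Types (x y : K) (M : R).

Definition vge M x := (M%:E <= v x)%E.

Lemma vge0 M : vge M 0.
Proof. by rewrite /vge val0 leey. Qed.

Lemma vge_le M M' x : M' <= M -> vge M x -> vge M' x.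
Proof. by move=> MM'; apply: le_trans; rewrite lee_fin. Qed.

Lemma vgeD M x y : vge M x -> vge M y -> vge M (x + y).
Proof. by move=> hx hy; apply: le_trans (valD v x y); rewrite le_min; apply/andP. Qed.

Lemma vgeN M x : vge M (- x) = vge M x.
Proof. by rewrite /vge valN. Qed.

Lemma vgeM M M' x y : vge M x -> vge M' y -> vge (M + M') (x * y).
Proof. by rewrite /vge EFinD Defs.valM; apply: leeD. Qed.

Lemma vge_sum M (I : Type) (s : seq I) (P : pred I) (F : I -> K) :
  (forall i, P i -> vge M (F i)) -> vge M (\sum_(i <- s | P i) F i).
Proof.
move=> h; elim/big_ind: _ => //; first exact: vge0.
by move=> x y; apply: vgeD.
Qed.

Lemma vge_vring (a : vring v) : vge 0 a.
Proof. exact: vring_ge0. Qed.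

Lemma vgeMl M (a : vring v) x : vge M x -> vge M (vring_val a * x).
Proof. by rewrite -{2}[M]add0r; apply/vgeM/vge_vring. Qed.

Lemma vge_eq0 x : (forall M, vge M x) -> x = 0.
Proof.
move=> h; apply/eqP; rewrite -(val_eq_pinfty v); apply/eqP/eqyP => M _; exact: h.
Qed.

Lemma vge_ex x : exists M, vge M x.
Proof.
have [->|x0] := eqVneq x 0; first by exists 0; apply: vge0.
by exists (fine (v x)); rewrite /vge fineK // val_fin.
Qed.

(** The valuation need not be discrete, so e depends on a; uniform bounds come from
    [uniform_positive], over finite families. *)
Lemma vmax_vge (a : vring v) : a \in @in_vmax R K v -> exists2 e, 0 < e & vge e a.
Proof.
have [a0|a0] := eqVneq (vring_val a) 0; first by exists 1 => //; rewrite a0; apply: vge0.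
rewrite inE -(fineK (val_fin v a0)) lte_fin => va.
by exists (fine (v a)); rewrite // /vge fineK // val_fin.
Qed.
End ValuationBounds.
Arguments vge {R K} v M x.

(** * Approximate ideal membership and functionals on polynomials *)

Section SmallPolynomials.
Context {R : realType} {K : fieldType} {v : valuation R K} {n N : nat}.
Variable a : 'I_N -> vring v ^ n.
Local Notation poly := (mpoly n (vring v)).
Implicit Types (g h p q : poly) (e C M : R) (i : 'I_N).

(** Values are moved to K, where the functionals have their coefficients and E can be inverted. *)
Definition ev i g : K := vring_val (meval (a i) g).

Lemma ev0 i : ev i 0 = 0. Proof. by rewrite /ev meval0. Qed.
Lemma ev1 i : ev i 1 = 1. Proof. by rewrite /ev meval1. Qed.
Lemma evD i g h : ev i (g + h) = ev i g + ev i h. Proof. by rewrite /ev mevalD. Qed.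
Lemma evB i g h : ev i (g - h) = ev i g - ev i h. Proof. by rewrite /ev mevalB. Qed.
Lemma evM i g h : ev i (g * h) = ev i g * ev i h. Proof. by rewrite /ev mevalM. Qed.
Lemma evZ i (c : vring v) g : ev i (c *: g) = vring_val c * ev i g.
Proof. by rewrite /ev mevalZ. Qed.
Lemma evX i g t : ev i (g ^+ t) = ev i g ^+ t.
Proof. by elim: t => [|t IH]; rewrite ?expr0 ?ev1 // !exprS evM IH. Qed.
Lemma ev_sum i (I : Type) (s : seq I) (F : I -> poly) :
  ev i (\sum_(j <- s) F j) = \sum_(j <- s) ev i (F j).
Proof.
elim: s => [|j s IH]; first by rewrite !big_nil ev0.
by rewrite !big_cons evD IH.
Qed.

Definition coef_vge e p := forall I, vge v e (vring_val (mcoeff I p)).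

Lemma coef_vgeD e p q : coef_vge e p -> coef_vge e q -> coef_vge e (p + q).
Proof. by move=> hp hq I; rewrite mcoeffD; apply: (vgeD (hp I) (hq I)). Qed.

Lemma coef_vge_sum e (I : Type) (s : seq I) (F : I -> poly) :
  (forall j, coef_vge e (F j)) -> coef_vge e (\sum_(j <- s) F j).
Proof.
move=> h; elim/big_ind: _ => // [I'|x y]; last exact: coef_vgeD.
by rewrite mcoeff0; apply: vge0.
Qed.

Lemma coef_vgeM e h p : coef_vge e p -> coef_vge e (h * p).
Proof.
move=> hp I; rewrite mcoeffM; elim/big_ind: _ => [|x y hx hy|j _].
- exact: vge0.
- exact: (vgeD hx hy).
- exact: (vgeMl (mcoeff j.1 h) (hp j.2)).
Qed.

(* An algebraic substitute for the ideal of polynomials lying in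
   (f_1, ..., f_r) + {coefficients of valuation >= e} of the Tate algebra, when
   the points [a i] are zeros of f: the series are truncated far enough. *)
Definition small e g := forall C, exists2 q,
  coef_vge e (g - q) & forall i, vge v C (ev i q).

Lemma small_le e e' g : e' <= e -> small e g -> small e' g.
Proof.
move=> ee h C; have [q hq hC] := h C; exists q => // I.
exact: vge_le ee (hq I).
Qed.

Lemma small0 e : small e 0.
Proof.
move=> C; exists 0 => [I|i]; first by rewrite subrr mcoeff0; apply: vge0.
by rewrite ev0; apply: vge0.
Qed.

Lemma smallD e g h : small e g -> small e h -> small e (g + h).
Proof.
move=> hg hh C; have [p hp pC] := hg C; have [q hq qC] := hh C.
exists (p + q) => [|i]; last by rewrite evD; apply: vgeD.
by rewrite opprD addrACA; apply: coef_vgeD.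
Qed.

Lemma smallM e h g : small e g -> small e (h * g).
Proof.
move=> hg C; have [p hp pC] := hg C; exists (h * p) => [|i].
  by rewrite -mulrBr; apply: coef_vgeM.
by rewrite evM; apply/vgeMl/pC.
Qed.

Section Generation.
Variables (e : R) (d : nat) (b : 'I_d -> poly) (E : poly).
Hypothesis E_idem : small e (E * E - E).

(** Multiplying by E plays the role of localizing at m: in general the b_l generate only the local
    factor, not the whole algebra. *)
Definition generated g := exists c : 'I_d -> vring v,
  small e (E * (g - \sum_l c l *: b l)).

Hypothesis gen1 : generated 1.
Hypothesis genX : forall k j, generated (mpolyX _ (mnm1 k) * b j).

Lemma generated0 : generated 0.
Proof.
exists (fun=> 0); rewrite big1 => [|l _]; last by rewrite scale0r.
by rewrite subrr mulr0; apply: small0.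
Qed.

Lemma generatedD g h : generated g -> generated h -> generated (g + h).
Proof.
move=> [c hc] [c' hc']; exists (fun l => c l + c' l).
under eq_bigr do rewrite scalerDl.
by rewrite big_split opprD addrACA mulrDr; apply: smallD.
Qed.

Lemma generatedZ (x : vring v) g : generated g -> generated (x *: g).
Proof.
move=> [c hc]; exists (fun l => x * c l).
under eq_bigr do rewrite -scalerA.
by rewrite -scaler_sumr -scalerBr -scalerAr -mul_mpolyC; apply: smallM.
Qed.

Lemma generated_sum (I : Type) (s : seq I) (F : I -> poly) :
  (forall j, generated (F j)) -> generated (\sum_(j <- s) F j).
Proof.
by move=> h; elim/big_ind: _ => // [|x y]; [exact: generated0 | exact: generatedD].
Qed.

Lemma generatedX k g : generated g -> generated (mpolyX _ (mnm1 k) * g).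
Proof.
move=> [c hc].
have [c' hc'] : generated (\sum_l c l *: (mpolyX _ (mnm1 k) * b l)).
  by apply: generated_sum => l; apply/generatedZ/genX.
exists c'; set B' := \sum_l c' l *: _ in hc' *.
have -> : E * (mpolyX _ (mnm1 k) * g - B') =
    mpolyX _ (mnm1 k) * (E * (g - \sum_l c l *: b l)) +
    E * (\sum_l c l *: (mpolyX _ (mnm1 k) * b l) - B').
  rewrite (_ : \sum_l c l *: (mpolyX _ (mnm1 k) * b l) = mpolyX _ (mnm1 k) * \sum_l c l *: b l).
    by ring.
  by rewrite mulr_sumr; apply: eq_bigr => l _; rewrite scalerAr.
by apply: smallD => //; apply: smallM.
Qed.

(** Only the relations for 1 and for the x_k b_j are used, finitely many, so the same e serves every
    monomial. *)
Lemma generated_monomial I : generated (mpolyX _ I).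
Proof.
(* An arbitrary generated factor p lets the claim pass through products of variables. *)
suff h p : generated p -> generated (mpolyX _ I * p) by rewrite -[mpolyX _ _]mulr1; apply: h.
rewrite mpolyXE_id; elim/big_ind: _ p => [p|x y hx hy p hp|k _ p hp].
- by rewrite mul1r.
- by rewrite -mulrA; apply/hx/hy.
elim: (I k) => [|t IH]; first by rewrite expr0 mul1r.
by rewrite exprS -mulrA; apply: generatedX.
Qed.

Lemma small_idem_exp t : small e (E * E ^+ t - E).
Proof.
elim: t => [|t IH]; first by rewrite expr0 mulr1 subrr; apply: small0.
have -> : E * E ^+ t.+1 - E = E * (E * E ^+ t - E) + (E * E - E) by rewrite exprS; ring.
by apply: smallD => //; apply: smallM.
Qed.

(** The power of E in front of the combination is there to cancel: after division by E(a_i)^(t+1)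
    the b_l appear without denominators, and the functional kills them. *)
Lemma monomial_reduction I t : exists c : 'I_d -> vring v,
  small e (E * mpolyX _ I - E ^+ t.+1 * \sum_l c l *: b l).
Proof.
have [c hc] := generated_monomial I; exists c; set B := \sum_l _ in hc *.
have -> : E * mpolyX _ I - E ^+ t.+1 * B =
    E * (mpolyX _ I - B) + (- B) * (E * E ^+ t - E) by rewrite exprS; ring.
by apply: smallD => //; apply/smallM/small_idem_exp.
Qed.

Hypothesis e_gt0 : 0 < e.
Hypothesis E_unit : forall i, v (ev i E) = 0%E.
Variable w : 'I_N -> K.
Hypothesis w_b : forall j, \sum_i w i * ev i (b j) = 0.

Let E0 i : ev i E != 0.
Proof. by apply/eqP => h; have := E_unit i; rewrite h val0. Qed.

Let u i := (ev i E)^-1.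
Let vu i : vge v 0 (u i).
Proof. by have := valV v (E0 i); rewrite E_unit adde0 /vge /u => ->. Qed.

Let vut i t : vge v 0 (u i ^+ t).
Proof.
elim: t => [|t IH]; first by rewrite expr0 /vge Defs.val1.
by rewrite exprS -[0]addr0; apply: vgeM.
Qed.

(* Every step of the induction gains [e], the functional sum_i w_i ev_i being
   killed by the [b j]. *)
Lemma functional_vge c : (forall i, vge v c (w i)) -> forall s I t,
  vge v (e *+ s + c) (\sum_i w i * (ev i (mpolyX _ I) * u i ^+ t)).
Proof.
move=> wc; have wge M i x : vge v M x -> vge v (M + c) (w i * x).
  by rewrite addrC; apply: vgeM.
elim=> [|s IH] I t.
  by apply: vge_sum => i _; apply/wge/vgeMl/vut.
have [C hC] := monomial_reduction I t.
have [q qe qC] := hC (e *+ s.+1).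
set r := _ - q in qe.
(* Evaluate E x^I = E^(t+1) B + q + r, with B the combination of the b_l, and divide by
   E(a_i)^(t+1). The first sum vanishes by [w_b]; the second meets the target bound by the choice of
   q. *)
have -> : \sum_i w i * (ev i (mpolyX _ I) * u i ^+ t) =
    \sum_l vring_val (C l) * (\sum_i w i * ev i (b l)) +
    \sum_i w i * (ev i q * u i ^+ t.+1) +
    \sum_(J <- msupp r) vring_val (mcoeff J r) *
       (\sum_i w i * (ev i (mpolyX _ J) * u i ^+ t.+1)).
  under [X in _ = X + _ + _]eq_bigr do rewrite mulr_sumr.
  under [X in _ = _ + X]eq_bigr do rewrite mulr_sumr.
  rewrite [X in _ = X + _ + _]exchange_big [X in _ = _ + X]exchange_big -!big_split /=.
  apply: eq_bigr => i _.
  have -> : \sum_l vring_val (C l) * (w i * ev i (b l)) =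
      w i * ev i (\sum_l C l *: b l).
    by rewrite ev_sum mulr_sumr; apply: eq_bigr => l _; rewrite evZ; ring.
  have -> : \sum_(J <- msupp r) vring_val (mcoeff J r) *
      (w i * (ev i (mpolyX _ J) * u i ^+ t.+1)) = w i * (ev i r * u i ^+ t.+1).
    rewrite [in RHS](mpolyE r) ev_sum mulr_suml mulr_sumr.
    by apply: eq_bigr => l _; rewrite evZ; ring.
  rewrite -!mulrDr; congr (_ * _).
  rewrite /r !evB !evM evX; set B := ev i (\sum_l _).
  have uE : u i * ev i E = 1 by rewrite mulVf ?E0.
  have uEt : u i ^+ t.+1 * ev i E ^+ t.+1 = 1 by rewrite -exprMn uE expr1n.
  have uSt : u i ^+ t.+1 * ev i E = u i ^+ t by rewrite exprSr -mulrA uE mulr1.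
  move: uEt uSt; set U := u i ^+ t.+1; set Et := ev i E ^+ t.+1 => uEt <-.
  rewrite -[B in RHS]mul1r -[in X in _ = X + _ + _]uEt; ring.
rewrite big1 ?add0r => [|l _]; last by rewrite w_b mulr0.
apply: vgeD.
  by apply: vge_sum => i _; apply: wge; rewrite -[_ *+ _]addr0; apply: vgeM.
(* The coefficients of r contribute the gain e; the induction hypothesis is needed at t + 1, hence
   its generality in t. *)
rewrite mulrS -addrA; apply: vge_sum => J _.
by apply: vgeM (IH J t.+1); apply: qe.
Qed.

(** At a monomial, [functional_vge] with t = 0 bounds the valuation below by s e + c for every s, so
    the value is 0 because e > 0. Linearity gives the rest. *)
Lemma functional_eq0 g : \sum_i w i * ev i g = 0.
Proof.
have [c wc] : exists c, forall i, vge v c (w i).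
  have /choice[c wc] i := vge_ex (v := v) (w i).
  exists (\big[Order.min/0]_i c i) => i.
  by apply: vge_le (wc i); apply: bigmin_le.
have L0 I : \sum_i w i * ev i (mpolyX _ I) = 0.
  apply: (vge_eq0 (v := v)) => M.
  pose s := Num.bound `|(M - c) / e|.
  apply: (@vge_le _ _ _ (e *+ s + c)); last first.
    rewrite (eq_bigr (fun i => w i * (ev i (mpolyX _ I) * u i ^+ 0))).
      exact: functional_vge.
    by move=> i _; rewrite expr0 mulr1.
  rewrite -lerBlDr -mulr_natl -ler_pdivrMr //.
  by apply: le_trans (ler_norm _) _; apply/ltW/archi_boundP/normr_ge0.
have -> : \sum_i w i * ev i g =
    \sum_(J <- msupp g) vring_val (mcoeff J g) * (\sum_i w i * ev i (mpolyX _ J)).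
  under [RHS]eq_bigr do rewrite mulr_sumr.
  rewrite [RHS]exchange_big /=; apply: eq_bigr => i _.
  rewrite [in LHS](mpolyE g) ev_sum mulr_sumr.
  by apply: eq_bigr => l _; rewrite evZ; ring.
by apply: big1_seq => J _; rewrite L0 mulr0.
Qed.
End Generation.

(** For each i0, a product over i != i0 of polynomials x_k - (a_i)_k, with k a coordinate where a_i
    and a_i0 differ, vanishes at every point but a_i0. *)
Lemma functional_inj (w : 'I_N -> K) : injective a ->
  (forall g, \sum_i w i * ev i g = 0) -> forall i, w i = 0.
Proof.
move=> ainj w0 i0.
have /choice[g gP] i : exists g, i != i0 -> ev i g = 0 /\ ev i0 g != 0.
  have [->|ii0] := eqVneq i i0; first by exists 0.
  have [k ak] : exists k, a i k != a i0 k.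
    apply/existsP; rewrite -negb_forall; apply: contra ii0 => /forallP h.
    by apply/eqP/ainj/ffunP => k; apply/eqP.
  exists (mpolyX _ (mnm1 k) - mpolyC _ (a i k)) => _.
  rewrite !evB /ev !mevalXU !mevalC subrr; split => //.
  by rewrite subr_eq0 eq_sym; apply: contra ak => /eqP/val_inj ->.
have ev_prod i (P : pred 'I_N) : ev i (\prod_(j | P j) g j) = \prod_(j | P j) ev i (g j).
  by elim/big_ind2: _ => // [|x x' y y' <- <-]; [exact: ev1 | exact: evM].
have := w0 (\prod_(i | i != i0) g i).
rewrite (bigD1 i0) //= [X in _ + X]big1 ?addr0 => [|i ii0]; last first.
  by rewrite ev_prod (bigD1 i) //= (gP i ii0).1 mul0r mulr0.
move=> /eqP; rewrite mulf_eq0 => /orP[/eqP //|]; rewrite ev_prod.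
by rewrite (negbTE (_ : _ != 0)) //; apply/prodf_neq0 => i /gP[].
Qed.
End SmallPolynomials.

(** * Reduction of Tate series *)

Section Reduction.
Context {R : realType} {K : fieldType} {v : valuation R K} {n : nat}.
Local Notation poly := (mpoly n (vring v)).
Implicit Types (g h p : poly) (f : tate v n).

Definition redp : poly -> mpoly n (residue v) := map_mpoly (res (v := v)).

Lemma redpB : {morph redp : g h / g - h}. Proof. exact: rmorphB. Qed.
Lemma redpM : {morph redp : g h / g * h}. Proof. exact: rmorphM. Qed.
Lemma redpZ c g : redp (c *: g) = res c *: redp g. Proof. exact: map_mpolyZ. Qed.
Lemma redpX I : redp (mpolyX _ I) = mpolyX _ I. Proof. exact: map_mpolyX. Qed.
Lemma redp_sum (I : Type) (s : seq I) (P : pred I) (F : I -> poly) :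
  redp (\sum_(i <- s | P i) F i) = \sum_(i <- s | P i) redp (F i).
Proof. exact: raddf_sum. Qed.

Lemma redp_surj (q : mpoly n (residue v)) : exists g, redp g = q.
Proof.
exists (\sum_(I <- msupp q) (repr (mcoeff I q) : vring v) *: mpolyX _ I).
rewrite redp_sum [RHS]mpolyE; apply: eq_bigr => I _.
by rewrite redpZ redpX /res reprK.
Qed.

Lemma redp_eval g (a : 'I_n -> vring v) :
  meval (fun k => res (a k)) (redp g) = res (meval a g).
Proof.
rewrite {1}[g]mpolyE redp_sum raddf_sum /= [in RHS]mevalE raddf_sum; apply: eq_bigr => I _.
rewrite redpZ redpX mevalZ mevalX -[RHS]/(res _) rmorphM rmorph_prod.
by congr (_ * _); apply: eq_bigr => k _; rewrite rmorphXn.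
Qed.

(** Finitely many coefficients are nonzero, and all lie in the maximal ideal, so their valuations
    have a positive lower bound. *)
Lemma coef_vge_ex p : redp p = 0 -> exists2 e, 0 < e & coef_vge e p.
Proof.
move=> rp.
have [t e e' ee|t|e e0 he] := @uniform_positive R (seq_sub (msupp p))
    (fun I e => vge v e (vring_val (mcoeff (ssval I) p))).
- exact: vge_le.
- by apply: vmax_vge; rewrite -res_eq0 -mcoeff_map_mpoly -/(redp p) rp mcoeff0.
exists e => // I; have [Ip|] := boolP (I \in msupp p); first exact: (he (SeqSub Ip)).
by rewrite -mcoeff_eq0 => /eqP ->; apply: vge0.
Qed.

Definition trunc f (N : nat) : poly := \sum_(I : bmultinom n N) f I *: mpolyX _ I.

Lemma mcoeff_trunc f N I : mcoeff I (trunc f N) = if (mdeg I < N)%N then f I else 0.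
Proof.
case: ltnP => IN; first exact: (mcoeff_mpoly f).
rewrite raddf_sum big1 //= => J _; rewrite mcoeffZ mcoeffX.
case: eqP => [JI|]; last by rewrite mulr0.
by have := bmdeg J; rewrite JI ltnNge IN.
Qed.

Lemma meval_trunc f (a : vring v ^ n) N : meval a (trunc f N) = tate_psum f a N.
Proof. by rewrite raddf_sum; apply: eq_bigr => I _; rewrite /= mevalZ mevalX. Qed.

Lemma redp_trunc f N : (forall I, (N <= mdeg I)%N -> f I \in @in_vmax R K v) ->
  redp (trunc f N) = red f.
Proof.
move=> fN; apply/mpolyP => I; rewrite mcoeff_map_mpoly mcoeff_trunc mcoeff_red.
by case: ltnP => // /fN; rewrite -res_eq0 => /eqP ->; apply: raddf0.
Qed.

(** All but finitely many coefficients have valuation above 1, so the bound is uniform even when the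
    value group is dense. *)
Lemma tate_vge_ex f : exists2 e, 0 < e &
  forall I, f I \in @in_vmax R K v -> vge v e (f I).
Proof.
have [N fN] := tate_cvg f 1.
have [t e e' ee h /h|t|e e0 he] := @uniform_positive R (bmultinom n N)
    (fun I e => f I \in @in_vmax R K v -> vge v e (f I)).
- exact: vge_le.
- have [/vmax_vge[e e0 he]|/negP h] := boolP (f t \in @in_vmax R K v); first by exists e.
  by exists 1.
exists (Order.min 1 e) => [|I fI]; first by rewrite lt_min ltr01.
have [IN|NI] := ltnP (mdeg I) N.
  by apply: vge_le (he (BMultinom IN) fI); rewrite ge_min lexx orbT.
by apply: (@vge_le _ _ _ 1); [rewrite ge_min lexx | exact/ltW/fN].
Qed.
End Reduction.

(** * Local generators and the zeros over one maximal ideal *)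

Section Zeros.
Context {R : realType} {K : fieldType} {v : valuation R K} {n r : nat}.
Hypothesis v_complete : val_complete v.
Variable f : 'I_r -> tate v n.
Local Notation poly := (mpoly n (vring v)).
Local Notation kx := (mpoly n (residue v)).
Local Notation A := (red_alg f).
Local Notation phi := (red_alg_scalar f).

Lemma zero_psum (a : vring v ^ n) : zeros (range f) a ->
  forall j C, exists N0, forall N, (N0 <= N)%N -> (C%:E < v (tate_psum (f j) a N))%E.
Proof.
move=> a0 j C; have [N0 h] := tate_evalP (f j) a v_complete C.
exists N0 => N /h; rewrite (a0 (f j)) ?subr0 //; by exists j.
Qed.

Lemma vmax_bound : exists b, forall j I, (b <= mdeg I)%N -> f j I \in @in_vmax R K v.
Proof.
have /choice[b bP] j := red_bound (f j).
exists (\max_j b j)%N => j I hI; apply: bP.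
exact: leq_trans (leq_bigmax j) hI.
Qed.

(** Lift the relation between g and the f_j to R[x]. The f_j are cut at a degree M depending on C,
    which makes the values at the zeros small; the coefficients between degrees b and M lie in the
    maximal ideal, with valuations at least an e2 independent of M. *)
Lemma small_red_ideal N (a : 'I_N -> vring v ^ n) (g : poly) :
  (forall i, zeros (range f) (a i)) -> red_ideal f (redp g) ->
  exists2 e, 0 < e & small a e g.
Proof.
move=> a0 [c cE].
have /choice[H HE] j := redp_surj (c j).
have [b bP] := vmax_bound.
have [e1 e1_gt0 he1] : exists2 e, 0 < e & coef_vge e (g - \sum_j H j * trunc (f j) b).
  apply: coef_vge_ex; rewrite redpB redp_sum cE; apply/eqP; rewrite subr_eq0; apply/eqP.
  by apply: eq_bigr => j _; rewrite redpM HE redp_trunc // => I; apply: bP.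
have [|j|e2 e2_gt0 he2] := @uniform_positive R 'I_r
    (fun j e => forall I, f j I \in @in_vmax R K v -> vge v e (f j I)).
- by move=> j e e' ee h I fI; apply: vge_le ee (h I fI).
- exact: tate_vge_ex.
exists (Order.min e1 e2) => [|C]; first by rewrite lt_min e1_gt0.
have /choice[N0 N0P] (ij : 'I_N * 'I_r) := zero_psum (a0 ij.1) ij.2 C.
pose M := maxn b (\max_ij N0 ij).
exists (\sum_j H j * trunc (f j) M) => [|i]; last first.
  rewrite ev_sum; apply: vge_sum => j _; rewrite evM; apply: vgeMl.
  rewrite /vge /ev meval_trunc; apply/ltW/(N0P (i, j)).
  by rewrite leq_max (leq_bigmax (i, j)) orbT.
have -> : g - \sum_j H j * trunc (f j) M =
    (g - \sum_j H j * trunc (f j) b) + \sum_j H j * (trunc (f j) b - trunc (f j) M).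
  by under [X in _ = _ + X]eq_bigr do rewrite mulrBr; rewrite sumrB; ring.
apply: coef_vgeD => [I|]; first by apply: vge_le (he1 I); rewrite ge_min lexx.
apply: coef_vge_sum => j; apply: coef_vgeM => I.
rewrite mcoeffB !mcoeff_trunc.
have h0 : vge v (Order.min e1 e2) (vring_val (0 : vring v)) by apply: vge0.
have [Ib|bI] := ltnP (mdeg I) b.
  by rewrite ifT ?subrr //; apply: leq_trans Ib (leq_maxl _ _).
rewrite sub0r; case: ifP => _; last by rewrite oppr0.
rewrite /= vgeN; apply: vge_le (he2 j I (bP j I bI)).
by rewrite ge_min lexx orbT.
Qed.

Definition redA (g : poly) : A := quot_proj (red_ideal f) (redp g).

Lemma redAB : {morph redA : g h / g - h}.
Proof. by move=> g h; rewrite /redA redpB raddfB. Qed.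
Lemma redAM : {morph redA : g h / g * h}.
Proof. by move=> g h; rewrite /redA redpM rmorphM. Qed.
Lemma redAZ c g : redA (c *: g) = phi (res c) * redA g.
Proof. by rewrite /redA redpZ -mul_mpolyC rmorphM. Qed.
Lemma redA_sum (I : Type) (s : seq I) (F : I -> poly) :
  redA (\sum_(i <- s) F i) = \sum_(i <- s) redA (F i).
Proof. by rewrite /redA redp_sum raddf_sum. Qed.

Lemma redA_surj (x : A) : exists g, redA g = x.
Proof. by have [g gE] := redp_surj (repr x); exists g; rewrite /redA gE; apply: quot_reprK. Qed.

Lemma redA_eq0 g : redA g = 0 -> red_ideal f (redp g).
Proof.
have -> : 0 = quot_proj (red_ideal f) 0 by rewrite raddf0.
by move=> /quot_projP; rewrite subr0.
Qed.

Hypothesis A_fin : finite_dim (red_space f).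

Lemma maxideal_prod (m : maxideal A) (T : finType) (u : T -> A) :
  (forall t, ~ m (u t)) -> ~ m (\prod_t u t).
Proof.
move=> mu; elim/big_ind: _ => // [|x y mx my /maxideal_prime[]//].
exact: maxideal_notin1.
Qed.

(* [E] lifts an idempotent e outside m killing finitely many elements of the
   kernel of the map to the localization at m. *)
Lemma local_generators (m : maxideal A) : exists (b : 'I_(dimension (local_space phi m)) -> poly) E,
  [/\ ~ m (redA E), redA (E * E - E) = 0,
      exists c : _ -> vring v, redA (E * (1 - \sum_l c l *: b l)) = 0 &
      forall k j, exists c : _ -> vring v,
        redA (E * (mpolyX _ (mnm1 k) * b j - \sum_l c l *: b l)) = 0].
Proof.
have := local_space_dimension A_fin m; set d := dimension _ => /has_dim_basis[b0 _ bs].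
pose lm : red_space f -> local_space phi m := loc_map (maxideal_compl m).
have lmlin : linear lm := loc_map_linear (phi := phi) m.
have /choice[b bE] l : exists g, lm (redA g) = b0 l.
  by have [x <-] := loc_map_surj A_fin (b0 l); have [g <-] := redA_surj x; exists g.
(* [None] stands for 1 and [Some (k, j)] for x_k b_j, the elements whose rewriting
   [generated_monomial] requires. *)
pose xs (o : option ('I_n * 'I_d)) := if o is Some (k, j) then mpolyX _ (mnm1 k) * b j else 1.
have hx o : exists cu : ('I_d -> vring v) * A,
    ~ m cu.2 /\ cu.2 * redA (xs o - \sum_l cu.1 l *: b l) = 0.
  have [c cE] := bs (lm (redA (xs o))).
  (* The relation holds in the localization, so some u outside m kills it in A. *)
  have [u mu uE] : exists2 u, ~ m u & u * redA (xs o - \sum_l (repr (c l) : vring v) *: b l) = 0.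
    apply/loc_map_eq0; rewrite redAB loc_map_zmod; apply/eqP; rewrite subr_eq0; apply/eqP.
    apply: etrans cE _.
    have -> : redA (\sum_l (repr (c l) : vring v) *: b l) =
        \sum_l (c l *: (redA (b l) : red_space f)).
      by rewrite redA_sum; under eq_bigr do rewrite redAZ /res reprK.
    change (\sum_l c l *: b0 l = lm (\sum_l c l *: (redA (b l) : red_space f))).
    rewrite linear_comb //.
    by apply: eq_bigr => l _; rewrite bE.
  by exists ((fun l => repr (c l) : vring v), u).
have /choice[cu cuP] := hx.
have mU := maxideal_prod (fun o => (cuP o).1).
set U := \prod_o _ in mU.
(* The Fitting idempotent e = t U is a multiple of every annihilator, hence kills all the relations
   at once. *)
have [e [t [eU ee /(_ m)[/(_ mU) e1 _]]]] := fitting_loc A_fin U.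
have [E EE] := redA_surj e.
have kill o : redA (E * (xs o - \sum_l (cu o).1 l *: b l)) = 0.
  rewrite redAM EE eU /U (bigD1 o) //= mulrAC -mulrA.
  by rewrite [X in _ * X]mulrCA [X in _ * X]mulrA (cuP o).2 mul0r mulr0.
exists b, E; split.
- have /loc_map_eq1[w mw we] := e1.
  rewrite EE => me; apply: (@maxideal_notin1 _ m); rewrite -(subrK e 1).
  apply: idealD => //; have : m (w * (1 - e)) by rewrite we; apply: ideal0.
  by case/maxideal_prime.
- by rewrite redAB redAM EE ee subrr.
- by exists (cu None).1; apply: (kill None).
- by move=> k j; exists (cu (Some (k, j))).1; apply: (kill (Some (k, j))).
Qed.

(** The last hypothesis says that each a_i lies over m. If N > d, a nonzero relation w between the
    evaluations holds on the b_l; [functional_eq0] extends it to all polynomials, against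
    [functional_inj]. *)
Lemma fiber_bound (m : maxideal A) N (a : 'I_N -> vring v ^ n) : injective a ->
  (forall i, zeros (range f) (a i)) ->
  (forall g i, ~ m (redA g) -> res (meval (a i) g) != 0) ->
  (N <= dimension (local_space phi m))%N.
Proof.
move=> ainj a0 am; have [b [E [mE EE [c1 g1] gX]]] := local_generators m.
have sm g : redA g = 0 -> exists2 e, 0 < e & small a e g.
  by move=> /redA_eq0; apply: small_red_ideal.
have [e1 e1_gt0 s1] := sm _ EE.
have [e2 e2_gt0 s2] := sm _ g1.
set d := dimension _ in b c1 g1 gX s2 *.
have [[k j] e e' ee [c hc]|[k j]|e3 e3_gt0 s3] := @uniform_positive R ('I_n * 'I_d)%type
    (fun kj e => generated a e b E (mpolyX _ (mnm1 kj.1) * b kj.2)).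
- by exists c; apply: small_le hc.
- by have [c /sm[e e_gt0 he]] := gX k j; exists e => //; exists c.
pose e := Order.min e1 (Order.min e2 e3).
have e_gt0 : 0 < e by rewrite !lt_min e1_gt0 e2_gt0.
have idE : small a e (E * E - E) by apply: small_le s1; rewrite ge_min lexx.
have gen1 : generated a e b E 1.
  by exists c1; apply: small_le s2; rewrite !ge_min lexx orbT.
have genX k j : generated a e b E (mpolyX _ (mnm1 k) * b j).
  have [c hc] := s3 (k, j); exists c; apply: small_le hc.
  by rewrite !ge_min lexx !orbT.
(* E is outside m, so its values at the a_i are units of R. *)
have uE i : v (ev a i E) = 0%E.
  apply/eqP; rewrite eq_le vring_ge0 andbT leNgt.
  by have := am E i mE; rewrite res_eq0 inE.
rewrite leqNgt; apply/negP => dN.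
pose B := \matrix_(i < N, l < d) ev a i (b l).
(* B has more rows than columns, so its left kernel is nonzero. *)
have /rowV0Pn[w /sub_kermxP wB /eqP] : kermx B != 0.
  rewrite kermx_eq0 /row_free; apply: contraTneq dN => rB.
  by rewrite -leqNgt -rB rank_leq_col.
apply; apply/rowP => i; rewrite mxE; move: i.
apply: (functional_inj ainj) => g.
apply: (functional_eq0 idE gen1 genX e_gt0 uE) => l.
have := congr1 (fun M : 'rV_d => M 0 l) wB; rewrite !mxE => wBl.
by rewrite -[RHS]wBl; apply: eq_bigr => i _; rewrite mxE.
Qed.
End Zeros.

(** * Counting zeros *)

Section PointIdeal.
Context {R : realType} {K : fieldType} {v : valuation R K} {n r : nat}.
Hypothesis v_complete : val_complete v.
Variable f : 'I_r -> tate v n.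
Local Notation poly := (mpoly n (vring v)).
Local Notation kx := (mpoly n (residue v)).
Local Notation A := (red_alg f).
Local Notation phi := (red_alg_scalar f).

(** Truncate past the degree where the coefficients enter the maximal ideal and past the one where
    the partial sums at a have positive valuation, then compare residues. *)
Lemma zero_red (a : vring v ^ n) : zeros (range f) a ->
  forall j, meval (fun k => res (a k)) (red (f j)) = 0.
Proof.
move=> a0 j; have [b bP] := red_bound (f j).
have [N0 hN] := zero_psum v_complete a0 j 0.
pose N := maxn b N0.
rewrite -(redp_trunc (N := N)) => [|I NI]; last first.
  by apply: bP; apply: leq_trans NI; apply: leq_maxl.
apply/eqP; rewrite redp_eval res_eq0 meval_trunc inE.
by apply: hN; apply: leq_maxr.
Qed.

(** The ideal is the kernel of evaluation at x. It is maximal with residue field k because every q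
    is congruent to the scalar q(x) modulo it. *)
Lemma point_maxideal (x : 'I_n -> residue v) : (forall j, meval x (red (f j)) = 0) ->
  exists m : maxideal A, rational_maxideals phi m /\
    forall g : kx, m (quot_proj (red_ideal f) g) <-> meval x g = 0.
Proof.
move=> x0; have ker g : red_ideal f g -> meval x g = 0.
  move=> [c ->]; rewrite raddf_sum big1 // => j _.
  by rewrite /= mevalM x0 mulr0.
(* Evaluation on A through representatives; [ker] makes it independent of their choice. *)
pose pt (q : A) := meval x (repr q).
have ptE g : pt (quot_proj (red_ideal f) g) = meval x g.
  apply/eqP; rewrite -subr_eq0 -mevalB; apply/eqP/ker.
  exact/quot_projP/quot_reprK.
have surj (q : A) : exists g, q = quot_proj (red_ideal f) g.
  by exists (repr q); rewrite quot_reprK.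
have ptD p q : pt (p + q) = pt p + pt q.
  have [g ->] := surj p; have [h ->] := surj q.
  by rewrite -raddfD !ptE mevalD.
have ptM p q : pt (p * q) = pt p * pt q.
  have [g ->] := surj p; have [h ->] := surj q.
  by rewrite -rmorphM !ptE mevalM.
have ptphi c : pt (phi c) = c by rewrite [LHS]ptE mevalC.
have pt0 : pt 0 = 0 by apply: (addrI (pt 0)); rewrite -ptD !addr0.
pose I : ideal A := @Ideal A (fun q => pt q = 0) pt0
  (fun p q hp hq => etrans (ptD p q) (etrans (f_equal2 +%R hp hq) (addr0 0)))
  (fun p q hq => etrans (ptM p q) (etrans (f_equal (fun y => pt p * y) hq) (mulr0 _))).
have Iphi q : I (q - phi (pt q)).
  by rewrite /= -[- phi _]rmorphN ptD ptphi subrr.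
have Imax : is_maximal I.
  split=> [|J IJ J1 q Jq].
    by rewrite /= -(rmorph1 phi) ptphi => /eqP; rewrite oner_eq0.
  apply/eqP/negPn/negP => q0; apply: J1.
  (* J contains the nonzero scalar q(x), hence 1. *)
  have Jpt : J (phi (pt q)).
    rewrite -(subKr q (phi (pt q))); apply: idealD => //.
    by rewrite -mulN1r; apply/ideal_mul/IJ/Iphi.
  by rewrite -(rmorph1 phi) -(mulVf q0) rmorphM; apply: ideal_mul.
exists (MaxIdeal Imax); split=> [|g]; last by rewrite /= ptE.
exists (fun y => pt (repr y)) => [c|y].
  have /quot_projP h := quot_reprK (quot_proj (MaxIdeal Imax) (phi c)).
  have {h} : pt (repr (quot_proj (MaxIdeal Imax) (phi c)) - phi c) = 0 := h.
  by rewrite -[- phi c]rmorphN ptD ptphi => /eqP; rewrite subr_eq0 => /eqP.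
rewrite -[RHS]quot_reprK; apply/quot_projP.
by rewrite -opprB -mulN1r; apply: ideal_mul; apply: Iphi.
Qed.
End PointIdeal.

Lemma finite_set_bounded (T : choiceType) (S : set T) (D : nat) :
  (forall s : seq T, uniq s -> (forall x, x \in s -> S x) -> (size s <= D)%N) ->
  finite_set S.
Proof.
move=> h; apply: contrapT => /(infinite_set_fset D.+1)[B BS].
by rewrite ltnNge h ?fset_uniq // => x xB; exact: BS.
Qed.

(** * Summation over the rational maximal ideals *)

Section Count.
Context {R : realType} {K : fieldType} {v : valuation R K} {n r : nat}.
Hypothesis v_complete : val_complete v.
Variable f : 'I_r -> tate v n.
Hypothesis A_fin : finite_dim (red_space f).
Local Notation A := (red_alg f).
Local Notation phi := (red_alg_scalar f).

(** Local dimensions are positive with sum at most dim A, which therefore bounds the length of any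
    duplicate-free list of maximal ideals. *)
Lemma rational_maxideals_finite : finite_set (rational_maxideals phi).
Proof.
apply: (finite_set_bounded (D := dimension (red_space f))) => s us _.
apply: leq_trans (sum_local_dimension_leq A_fin us).
rewrite -sum1_size; apply: leq_sum => m _.
exact: local_space_dimension_gt0.
Qed.

(** Double counting of pairs of an ideal and a zero over it: each zero lies over the kernel of
    evaluation at its reduction, and [fiber_bound] bounds the zeros over each ideal. Stated for
    sequences, the bound yields first the finiteness of the zero set, then its cardinality. *)
Lemma size_zeros_leq (s : seq (vring v ^ n)) : uniq s ->
  (forall a, a \in s -> zeros (range f) a) ->
  (size s <= \sum_(m <- fset_set (rational_maxideals phi)) dimension (local_space phi m))%N.
Proof.
move=> us sz.
pose over (m : maxideal A) (a : vring v ^ n) :=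
  `[< forall g, ~ m (redA f g) -> res (meval a g) != 0 >].
apply: (@leq_trans (\sum_(m <- fset_set (rational_maxideals phi)) count (over m) s)%N).
  under eq_bigr do rewrite -sum1_count big_mkcond.
  rewrite exchange_big -sum1_size /= big_seq [X in (_ <= X)%N]big_seq.
  apply: leq_sum => a /sz az.
  have [m [mr mP]] := point_maxideal (zero_red v_complete az).
  have mS : m \in fset_set (rational_maxideals phi).
    by rewrite in_fset_set ?inE //; exact: rational_maxideals_finite.
  rewrite (big_rem m) //= ifT ?leq_addr //.
  by apply/asboolP => g mg; apply/eqP => g0; apply/mg/mP; rewrite redp_eval.
apply: leq_sum => m _; rewrite -size_filter.
pose t := in_tuple (filter (over m) s).
apply: (fiber_bound v_complete A_fin (a := fun i => tnth t i)) => [|i|g i].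
- by apply/tuple_uniqP; apply: filter_uniq.
- by apply: sz; have := mem_tnth i t; rewrite mem_filter => /andP[].
by have := mem_tnth i t; rewrite mem_filter => /andP[/asboolP h _]; apply: h.
Qed.
End Count.

Local Open Scope classical_set_scope.
Local Open Scope nat_scope.

Theorem theorem1p2 (R : realType) (K : fieldType) (v : valuation R K)
    (v_nontrivial : val_nontrivial v) (v_complete : val_complete v)
    (n r : nat) (f : 'I_r -> tate v n)
    (A_finite : finite_dim (red_space f)) :
  [/\ finite_set (zeros (range f)),
      finite_set (rational_maxideals (red_alg_scalar f)),
      (forall m, rational_maxideals (red_alg_scalar f) m ->
         finite_dim (local_space (red_alg_scalar f) m)) &
      #|` fset_set (zeros (range f))| <=
        \big[addn/0]_(m \in rational_maxideals (red_alg_scalar f))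
           dimension (local_space (red_alg_scalar f) m)
        <= dimension (red_space f)].
Proof.
have rfin := rational_maxideals_finite A_finite.
have zfin : finite_set (zeros (range f)).
  by apply: finite_set_bounded => s us sz; apply: (size_zeros_leq v_complete A_finite us sz).
split=> // [m _|]; first exact: local_space_finite_dim.
rewrite fsbig_finite // sum_local_dimension_leq ?fset_uniq // andbT.
rewrite size_zeros_leq ?fset_uniq // => a.
by rewrite in_fset_set // inE.
Qed.
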